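(* Let $f\in\Omega_{\mathcal{A}}$ be given by $f(z)=z+\sum_{n=2}^\infty a_nz^n$ for $z\in\mathbb{D}$. Then $$r+\sum_{n=2}^\infty|a_n|r^n\leq d\left(f(0),\partial f(\mathbb{D})\right)\quad\text{for}\quad 0\le r\leq\sqrt{2}-1.$$ The radius $\sqrt{2}-1$ is the best possible, i.e. it cannot be replaced by any larger number valid for all $f\in\Omega_{\mathcal{A}}$.
   Context: $\mathbb{D}=\{z\in\mathbb{C}:|z|<1\}$. $\mathcal{A}$ is the family of functions $f$ analytic in $\mathbb{D}$ with $f(0)=0$ and $f'(0)=1$. The class $\Omega_{\mathcal{A}}$ consists of all $f(z)=z+\sum_{n=2}^\infty a_nz^n\in\mathcal{A}$ with $\sum_{n=2}^\infty(n-1)|a_n|\leq 1/2$. $d(f(0),\partial f(\mathbb{D}))$ denotes the Euclidean distance between $f(0)$ and the boundary of $f(\mathbb{D})$. *)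

(* Defs.v *)
From Stdlib Require Export Reals.
From Coquelicot Require Export Coquelicot.
Open Scope R_scope.

Definition unit_disc (z : C) : Prop := Cmod z < 1.

(* Analytic means complex differentiable at every point of the open disc;
   values of [f] outside the disc are irrelevant. *)
Definition analytic_on_disc (f : C -> C) : Prop :=
  forall z : C, unit_disc z -> @ex_derive C_AbsRing C_NormedModule f z.

Definition class_A (f : C -> C) : Prop :=
  analytic_on_disc f /\
  f (RtoC 0) = RtoC 0 /\
  @is_derive C_AbsRing C_NormedModule f (RtoC 0) (RtoC 1).

(* f z = z + \sum_(n >= 2) a_n z^n on the disc.  Series over n >= 2 are written
   with the index shifted by 2, so [a 0] and [a 1] are never used. *)
Definition has_expansion (f : C -> C) (a : nat -> C) : Prop :=
  forall z : C, unit_disc z ->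
    @is_series C_AbsRing C_NormedModule
      (fun n : nat => (a (n + 2)%nat * z ^ (n + 2))%C) (f z - z)%C.

Definition Omega_A (f : C -> C) : Prop :=
  class_A f /\
  exists a : nat -> C,
    has_expansion f a /\
    ex_series (fun n : nat => (INR (n + 2) - 1) * Cmod (a (n + 2)%nat)) /\
    Series (fun n : nat => (INR (n + 2) - 1) * Cmod (a (n + 2)%nat)) <= 1 / 2.

Definition disc_image (f : C -> C) (w : C) : Prop :=
  exists z : C, unit_disc z /\ f z = w.

Definition frontier (S : C -> Prop) (w : C) : Prop :=
  forall eps : R, 0 < eps ->
    (exists u : C, S u /\ Cmod (u - w)%C < eps) /\
    (exists v : C, ~ S v /\ Cmod (v - w)%C < eps).

(* An infimum in the extended reals, +oo when [S] is empty. *)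
Definition dist_to_set (p : C) (S : C -> Prop) : Rbar :=
  Glb_Rbar (fun x : R => exists w : C, S w /\ x = Cmod (w - p)%C).

(* [Series] is meaningful only for convergent series, hence the first conjunct. *)
Definition Bohr_inequality (f : C -> C) (a : nat -> C) (r : R) : Prop :=
  ex_series (fun n : nat => Cmod (a (n + 2)%nat) * r ^ (n + 2)) /\
  Rbar_le
    (Finite (r + Series (fun n : nat => Cmod (a (n + 2)%nat) * r ^ (n + 2))))
    (dist_to_set (f (RtoC 0)) (frontier (disc_image f))).

(* Main.v *)
Require Import Defs.
From Stdlib Require Import Reals Arith Lra Lia.
From Coquelicot Require Import Coquelicot.
Open Scope R_scope.

(** Put [S = \sum_(n >= 2) |a_n|].  The hypothesis gives [S <= 1/2], hence
    [\sum_(n >= 2) n |a_n| <= 1], so [f z - z] is [rho]-Lipschitz on [|z| <= rho]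
    for every [rho < 1].  By Banach's fixed point theorem [f z = w] is solvable
    whenever [|w| < 1 - S]: the distance from [0] to the frontier is at least
    [1 - S], and [r + r^2 S <= 1 - S] follows from [S <= 1/2] and
    [r^2 + 2 r <= 1], i.e. [r <= sqrt 2 - 1].  Sharpness comes from [z + z^2/2],
    whose image has the frontier point [-1/2]. *)

(** * Limits of series in normed modules *)

(** The triangle inequality for partial sums, passed to the limit by continuity of the norm. *)
Lemma norm_is_series_le {K : AbsRing} {V : NormedModule K}
    (u : nat -> V) (l : V) (b : nat -> R) :
  is_series u l -> (forall n, norm (u n) <= b n) -> ex_series b ->
  norm l <= Series b.
Proof.
  intros Hu Hub Hb.
  assert (Hl : is_lim_seq (fun n => norm (sum_n u n)) (norm l)).
  { exact (filterlim_comp _ _ _ _ _ _ _ _ Hu (filterlim_norm l)). }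
  assert (Hs : is_lim_seq (sum_n b) (Series b)) by exact (Series_correct b Hb).
  refine (is_lim_seq_le _ _ (Finite _) (Finite _) _ Hl Hs).
  intros n; eapply Rle_trans; [apply norm_sum_n_m | now apply sum_n_m_le].
Qed.

(** Evaluates the series of the extremal function, which have a single nonzero term. *)
Lemma is_series_head {K : AbsRing} {V : NormedModule K} (u : nat -> V) :
  (forall n, u (S n) = zero) -> is_series u (u O).
Proof.
  intros Hu.
  apply (filterlim_ext (fun _ => u O)); [| apply filterlim_const].
  intros n; induction n as [|n IH].
  - now rewrite sum_O.
  - now rewrite sum_Sn, <- IH, Hu, plus_zero_r.
Qed.

(** * Uniqueness of the expansion coefficients *)

Lemma is_series_fst (u : nat -> C) (l : C) :
  @is_series C_AbsRing C_NormedModule u l ->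
  is_series (fun n => fst (u n)) (fst l).
Proof.
  intros Hu.
  apply (filterlim_ext (fun n => fst (sum_n (G := C_NormedModule) u n))).
  - intros n; induction n as [|n IH].
    + now rewrite !sum_O.
    + now rewrite !sum_Sn, <- IH.
  - refine (filterlim_comp _ _ _ _ _ _ _ _ Hu _).
    destruct l as [x y]; exact (@continuous_fst R_UniformSpace R_UniformSpace x y).
Qed.

Lemma is_series_snd (u : nat -> C) (l : C) :
  @is_series C_AbsRing C_NormedModule u l ->
  is_series (fun n => snd (u n)) (snd l).
Proof.
  intros Hu.
  apply (filterlim_ext (fun n => snd (sum_n (G := C_NormedModule) u n))).
  - intros n; induction n as [|n IH].
    + now rewrite !sum_O.
    + now rewrite !sum_Sn, <- IH.
  - refine (filterlim_comp _ _ _ _ _ _ _ _ Hu _).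
    destruct l as [x y]; exact (@continuous_snd R_UniformSpace R_UniformSpace x y).
Qed.

(** Padding with [k] zero coefficients turns each series into a genuine power series of positive
    radius; the identity theorem for real power series then applies. *)
Lemma real_series_coef_unique (k : nat) (a b : nat -> R) (h : R -> R) :
  (forall t, Rabs t < 1 -> is_series (fun n => a n * t ^ (n + k)) (h t)) ->
  (forall t, Rabs t < 1 -> is_series (fun n => b n * t ^ (n + k)) (h t)) ->
  forall n, a n = b n.
Proof.
  assert (Hs : forall c t, Rabs t < 1 ->
    is_series (fun n => c n * t ^ (n + k)) (h t) ->
    PSeries (PS_incr_n c k) t = h t).
  { intros c t Ht Hc.
    rewrite PSeries_incr_n; unfold PSeries; rewrite <- Series_scal_l.
    rewrite <- (is_series_unique _ _ Hc); apply Series_ext.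
    intros n; rewrite pow_add; ring. }
  assert (Hr : forall c,
    (forall t, Rabs t < 1 -> is_series (fun n => c n * t ^ (n + k)) (h t)) ->
    Rbar_lt 0 (CV_radius (PS_incr_n c k))).
  { intros c Hc.
    (* With a nonpositive radius the terms at [1 / 2] could not tend to 0, yet the series converges
       there. *)
    destruct (Rbar_lt_dec 0 (CV_radius (PS_incr_n c k))) as [H|H]; auto.
    exfalso.
    assert (Hh : Rabs (1 / 2) < 1) by (rewrite Rabs_pos_eq; lra).
    apply (CV_disk_outside (PS_incr_n c k) (1 / 2)).
    - apply Rbar_not_lt_le in H.
      eapply Rbar_le_lt_trans; [exact H|].
      simpl; rewrite Rabs_pos_eq; lra.
    - apply (is_lim_seq_incr_n _ k).
      apply is_lim_seq_ext with (fun n => c n * (1 / 2) ^ (n + k)).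
      + intros n; rewrite PS_incr_n_simplify.
        destruct (le_lt_dec k (n + k)) as [_|]; [|lia].
        now replace (n + k - k)%nat with n by lia.
      + apply ex_series_lim_0; eexists; now apply Hc. }
  intros Ha Hb n.
  assert (E : PS_incr_n a k (n + k) = PS_incr_n b k (n + k)).
  { apply PSeries_ext_recip; [now apply Hr | now apply Hr |].
    exists (mkposreal 1 Rlt_0_1); intros t Ht.
    assert (Ht' : Rabs t < 1).
    { change (Rabs (t - 0) < 1) in Ht; now rewrite Rminus_0_r in Ht. }
    rewrite !Hs; auto. }
  rewrite !PS_incr_n_simplify in E.
  destruct (le_lt_dec k (n + k)) as [_|]; [|lia].
  now replace (n + k - k)%nat with n in E by lia.
Qed.

(** Restricting to real [t] and separating real and imaginary parts reduces this to real series. It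
    carries the bound that [Omega_A] gives for some expansion over to any other one. *)
Lemma has_expansion_unique (f : C -> C) (a b : nat -> C) :
  has_expansion f a -> has_expansion f b ->
  forall n, a (n + 2)%nat = b (n + 2)%nat.
Proof.
  assert (Hd : forall t, Rabs t < 1 -> unit_disc (RtoC t)).
  { intros t Ht; unfold unit_disc; now rewrite Cmod_R. }
  intros Ha Hb n.
  assert (H1 : forall n, fst (a (n + 2)%nat) = fst (b (n + 2)%nat)).
  { apply (real_series_coef_unique 2 _ _ (fun t => fst (f (RtoC t) - RtoC t)%C));
      intros t Ht;
      [generalize (is_series_fst _ _ (Ha _ (Hd t Ht)))
      |generalize (is_series_fst _ _ (Hb _ (Hd t Ht)))];
      apply is_series_ext; intros m; rewrite <- RtoC_pow; simpl; ring. }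
  assert (H2 : forall n, snd (a (n + 2)%nat) = snd (b (n + 2)%nat)).
  { apply (real_series_coef_unique 2 _ _ (fun t => snd (f (RtoC t) - RtoC t)%C));
      intros t Ht;
      [generalize (is_series_snd _ _ (Ha _ (Hd t Ht)))
      |generalize (is_series_snd _ _ (Hb _ (Hd t Ht)))];
      apply is_series_ext; intros m; rewrite <- RtoC_pow; simpl; ring. }
  now apply injective_projections.
Qed.

(** * Contractions of a closed disc and a Lipschitz bound for powers *)

(** The iterates of [g] from 0 stay in the disc, and their increments are dominated by a geometric
    series. *)
Lemma contraction_fixed_point (g : C -> C) (q rho : R) :
  0 <= q < 1 -> 0 <= rho ->
  (forall z, Cmod z <= rho -> Cmod (g z) <= rho) ->
  (forall z w, Cmod z <= rho -> Cmod w <= rho ->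
     Cmod (g z - g w)%C <= q * Cmod (z - w)%C) ->
  exists z, Cmod z <= rho /\ g z = z.
Proof.
  intros Hq Hrho Hmap Hlip.
  set (u := fix u n := match n with O => RtoC 0 | S m => g (u m) end).
  set (d := fun n => (u (S n) - u n)%C).
  assert (Hu : forall n, Cmod (u n) <= rho).
  { induction n as [|n IH]; simpl; [now rewrite Cmod_0 | now apply Hmap]. }
  assert (Hd : forall n, Cmod (d n) <= Cmod (d O) * q ^ n).
  { induction n as [|n IH]; [simpl; lra|].
    eapply Rle_trans; [apply (Hlip (u (S n)) (u n)); apply Hu|].
    change (q * Cmod (d n) <= Cmod (d O) * (q * q ^ n)).
    apply (Rmult_le_compat_l q) in IH; lra. }
  assert (Hs : @ex_series C_AbsRing C_NormedModule d).
  { apply (@ex_series_le C_AbsRing C_CompleteNormedModule)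
      with (fun n => Cmod (d O) * q ^ n); [exact Hd|].
    apply (@ex_series_scal_l R_AbsRing), ex_series_geom.
    rewrite Rabs_pos_eq; lra. }
  destruct Hs as [l Hl].
  (* Telescoping leaves [u (S n)] alone because the iteration starts at 0. *)
  assert (Hsum : forall n, @sum_n C_NormedModule d n = u (S n)).
  { induction n as [|n IH].
    - rewrite sum_O; unfold d; simpl; ring.
    - rewrite sum_Sn, IH; unfold d.
      change (u (S n) + (u (S (S n)) - u (S n)) = u (S (S n)))%C; ring. }
  assert (Hlim : forall eps, 0 < eps ->
    exists n, Cmod (u n - l)%C < eps /\ Cmod (u (S n) - l)%C < eps).
  { intros eps Heps.
    destruct (proj1 (filterlim_locally_ball_norm _ _) Hl (mkposreal eps Heps))
      as [N HN].
    exists (S N); split.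
    - generalize (HN N (Nat.le_refl N)); now rewrite Hsum.
    - generalize (HN (S N) (Nat.le_succ_diag_r N)); now rewrite Hsum. }
  assert (Hlrho : Cmod l <= rho).
  { apply le_epsilon; intros eps Heps.
    destruct (Hlim eps Heps) as [n [Hn _]].
    replace l with (u n + - (u n - l))%C by ring.
    eapply Rle_trans; [apply Cmod_triangle|].
    rewrite Cmod_opp; generalize (Hu n); lra. }
  exists l; split; [exact Hlrho|].
  assert (E : Cmod (g l - l)%C <= 0).
  { apply le_epsilon; intros eps Heps.
    destruct (Hlim (eps / 2)) as [n [Hn1 Hn2]]; [lra|].
    (* As [g (u n)] is [u (S n)], both summands are small for the same [n], the first by the
       Lipschitz bound. *)
    replace (g l - l)%C with (- (g (u n) - g l) + (u (S n) - l))%C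
      by (simpl; ring).
    eapply Rle_trans; [apply Cmod_triangle|].
    rewrite Cmod_opp.
    generalize (Hlip (u n) l (Hu n) Hlrho) (Cmod_ge_0 (u n - l)%C); intros.
    nra. }
  assert (E0 : (g l - l)%C = 0).
  { apply Cmod_eq_0; generalize (Cmod_ge_0 (g l - l)%C); lra. }
  replace (g l) with ((g l - l) + l)%C by ring; rewrite E0; ring.
Qed.

(** Induction on [n], splitting the next difference as [z * (z ^ S n - w ^ S n) + (z - w) * w ^ S
    n]. *)
Lemma Cmod_pow_minus_le (z w : C) (rho : R) (n : nat) :
  Cmod z <= rho -> Cmod w <= rho ->
  Cmod (z ^ S n - w ^ S n)%C <= INR (S n) * rho ^ n * Cmod (z - w)%C.
Proof.
  intros Hz Hw.
  assert (Hrho : 0 <= rho) by (generalize (Cmod_ge_0 z); lra).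
  induction n as [|n IH].
  - rewrite !Cpow_1_r; simpl; lra.
  - rewrite (Cpow_S z), (Cpow_S w).
    replace (z * z ^ S n - w * w ^ S n)%C
      with (z * (z ^ S n - w ^ S n) + (z - w) * w ^ S n)%C by ring.
    eapply Rle_trans; [apply Cmod_triangle|].
    rewrite !Cmod_mult, Cmod_pow, (S_INR (S n)).
    assert (H1 : Cmod z * Cmod (z ^ S n - w ^ S n)%C
                 <= rho * (INR (S n) * rho ^ n * Cmod (z - w)%C)).
    { apply Rmult_le_compat; auto using Cmod_ge_0. }
    assert (H2 : Cmod (z - w)%C * Cmod w ^ S n <= Cmod (z - w)%C * rho ^ S n).
    { apply Rmult_le_compat_l; [apply Cmod_ge_0|].
      apply pow_incr; split; [apply Cmod_ge_0 | assumption]. }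
    replace (rho ^ S n) with (rho * rho ^ n) in * by reflexivity.
    lra.
Qed.

(** * Coefficient estimates, the disc covered by the image, and the Bohr inequality *)

Section Coefficients.

Variables (f : C -> C) (a : nat -> C).
Hypothesis Hf : has_expansion f a.
Hypothesis Hex : ex_series (fun n : nat => (INR (n + 2) - 1) * Cmod (a (n + 2)%nat)).
Hypothesis Hle : Series (fun n : nat => (INR (n + 2) - 1) * Cmod (a (n + 2)%nat)) <= 1 / 2.

(** With this shift, [Series c] is the sum called [S] in the overview. *)
Let c (n : nat) : R := Cmod (a (n + 2)%nat).

Lemma coef_le_weighted (n : nat) : 0 <= c n <= (INR (n + 2) - 1) * c n.
Proof.
  generalize (Cmod_ge_0 (a (n + 2)%nat)) (pos_INR n).
  rewrite plus_INR; simpl; fold (c n); intros; nra.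
Qed.

Lemma ex_series_coef : ex_series c.
Proof.
  apply (@ex_series_le R_AbsRing R_CompleteNormedModule)
    with (fun n => (INR (n + 2) - 1) * c n); [|exact Hex].
  intros n; destruct (coef_le_weighted n).
  change (Rabs (c n) <= (INR (n + 2) - 1) * c n).
  rewrite Rabs_pos_eq; assumption.
Qed.

Lemma Series_coef_bounds : 0 <= Series c <= 1 / 2.
Proof.
  split.
  - rewrite <- (Rmult_0_l (Series c)), <- Series_scal_l.
    apply Series_le; [|exact ex_series_coef].
    intros n; destruct (coef_le_weighted n); lra.
  - eapply Rle_trans; [|exact Hle].
    apply Series_le; [exact coef_le_weighted | exact Hex].
Qed.

(** Writing [n = (n - 1) + 1] splits the sum into two series, each at most [1 / 2]. *)
Lemma Series_index_coef :
  ex_series (fun n => INR (n + 2) * c n) /\ Series (fun n => INR (n + 2) * c n) <= 1.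
Proof.
  assert (E : forall n, (INR (n + 2) - 1) * c n + c n = INR (n + 2) * c n)
    by (intros; ring).
  split.
  - eapply ex_series_ext; [exact E|].
    apply (@ex_series_plus R_AbsRing); [exact Hex | exact ex_series_coef].
  - rewrite <- (Series_ext _ _ E), Series_plus;
      [| exact Hex | exact ex_series_coef].
    generalize Series_coef_bounds; unfold c in *; lra.
Qed.

(** The term of degree [n >= 2] has Lipschitz constant [n |a_n| rho^(n-1) <= rho n |a_n|], and the
    sum of [n |a_n|] is at most 1. *)
Lemma perturbation_lipschitz (rho : R) (z w : C) :
  rho < 1 -> Cmod z <= rho -> Cmod w <= rho ->
  Cmod ((f z - z) - (f w - w))%C <= rho * Cmod (z - w)%C.
Proof.
  intros Hrho Hz Hw.
  assert (Hrho0 : 0 <= rho) by (generalize (Cmod_ge_0 z); lra).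
  destruct Series_index_coef as [H1 H2].
  assert (Hs := is_series_minus _ _ _ _
    (Hf z (Rle_lt_trans _ _ _ Hz Hrho)) (Hf w (Rle_lt_trans _ _ _ Hw Hrho))).
  assert (Hb : ex_series (fun n => rho * Cmod (z - w)%C * (INR (n + 2) * c n))).
  { now apply (@ex_series_scal_l R_AbsRing). }
  eapply Rle_trans; [refine (norm_is_series_le _ _ _ Hs _ Hb)|].
  - intros n.
    change (Cmod (a (n + 2)%nat * z ^ (n + 2) - a (n + 2)%nat * w ^ (n + 2))%C
      <= rho * Cmod (z - w)%C * (INR (n + 2) * c n)).
    replace (a (n + 2)%nat * z ^ (n + 2) - a (n + 2)%nat * w ^ (n + 2))%C
      with (a (n + 2)%nat * (z ^ (n + 2) - w ^ (n + 2)))%C by ring.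
    rewrite Cmod_mult; fold (c n).
    replace (n + 2)%nat with (S (S n)) at 1 2 3 by lia.
    assert (Hpow : rho ^ S n <= rho).
    { rewrite <- (Rmult_1_r rho) at 2; simpl; apply Rmult_le_compat_l; [lra|].
      rewrite <- (pow1 n); apply pow_incr; lra. }
    assert (Hk : Cmod (z ^ S (S n) - w ^ S (S n))%C
                 <= INR (S (S n)) * rho * Cmod (z - w)%C).
    { eapply Rle_trans; [apply (Cmod_pow_minus_le z w rho); assumption|].
      apply Rmult_le_compat_r; [apply Cmod_ge_0|].
      apply Rmult_le_compat_l; [apply pos_INR | assumption]. }
    apply (Rmult_le_compat_l (c n)) in Hk; [lra | apply Cmod_ge_0].
  - rewrite Series_scal_l.
    rewrite <- (Rmult_1_r (rho * Cmod (z - w)%C)) at 2.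
    apply Rmult_le_compat_l; auto using Rmult_le_pos, Cmod_ge_0.
Qed.

(** Only degrees [n >= 2] occur, and there [|z|^n <= |z| <= rho]. *)
Lemma perturbation_bound (rho : R) (z : C) :
  rho < 1 -> Cmod z <= rho -> Cmod (f z - z)%C <= rho * Series c.
Proof.
  intros Hrho Hz.
  assert (Hrho0 : 0 <= rho) by (generalize (Cmod_ge_0 z); lra).
  rewrite <- Series_scal_l.
  apply (norm_is_series_le _ _ _ (Hf z (Rle_lt_trans _ _ _ Hz Hrho))).
  - intros n.
    change (Cmod (a (n + 2)%nat * z ^ (n + 2))%C <= rho * c n).
    rewrite Cmod_mult, Cmod_pow; fold (c n).
    rewrite (Rmult_comm rho); apply Rmult_le_compat_l; [apply Cmod_ge_0|].
    replace (n + 2)%nat with (S (S n)) by lia.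
    rewrite <- (Rmult_1_r rho); change (Cmod z ^ S (S n)) with (Cmod z * Cmod z ^ S n).
    apply Rmult_le_compat; auto using Cmod_ge_0, pow_le.
    rewrite <- (pow1 (S n)); apply pow_incr; split; [apply Cmod_ge_0 | lra].
  - apply (@ex_series_scal_l R_AbsRing); exact ex_series_coef.
Qed.

(* [f z = w] is the fixed point equation for [z |-> w - (f z - z)], a
   contraction of the closed disc of radius [|w| + Series c] into itself. *)
Lemma disc_subset_image (w : C) : Cmod w < 1 - Series c -> disc_image f w.
Proof.
  intros Hw.
  destruct Series_coef_bounds as [HS0 HS1].
  assert (Hw0 := Cmod_ge_0 w).
  (* The same number is contraction factor and radius: [perturbation_lipschitz] has the radius as
     its constant. *)
  destruct (contraction_fixed_point (fun z => w - (f z - z))%C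
    (Cmod w + Series c) (Cmod w + Series c)) as [z [Hz Ez]].
  - lra.
  - lra.
  - intros z Hz; unfold Cminus at 1.
    eapply Rle_trans; [apply Cmod_triangle|].
    rewrite Cmod_opp.
    assert (H := perturbation_bound (Cmod w + Series c) z ltac:(lra) Hz).
    nra.
  - intros z v Hz Hv.
    replace (w - (f z - z) - (w - (f v - v)))%C
      with (- ((f z - z) - (f v - v)))%C by ring.
    rewrite Cmod_opp; apply perturbation_lipschitz; auto; lra.
  - exists z; split; [unfold unit_disc; lra|].
    replace (f z) with (w - (w - (f z - z)) + z)%C by ring.
    rewrite Ez; ring.
Qed.

Lemma frontier_lower_bound (w : C) :
  frontier (disc_image f) w -> 1 - Series c <= Cmod w.
Proof.
  intros Hw; apply Rnot_lt_le; intros Hlt.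
  (* With this radius, the omitted point [v] near [w] still lies in the disc covered by the
     image. *)
  destruct (proj2 (Hw (1 - Series c - Cmod w) ltac:(lra))) as [v [Hv Hvw]].
  apply Hv, disc_subset_image.
  replace v with (w + (v - w))%C by ring.
  generalize (Cmod_triangle w (v - w)%C); lra.
Qed.

Lemma Bohr_inequality_of_coef (r : R) :
  f (RtoC 0) = RtoC 0 -> 0 <= r <= sqrt 2 - 1 -> Bohr_inequality f a r.
Proof.
  intros Hf0 [Hr0 Hr1].
  assert (Hq : (r + 1) * (r + 1) <= 2).
  { rewrite <- (sqrt_sqrt 2) by lra; apply Rmult_le_compat; lra. }
  assert (Hr : r < 1) by nra.
  destruct Series_coef_bounds as [HS0 HS1].
  (* Bounding each power by [r ^ 2] gives both convergence and the majorant [r * r * Series c]. *)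
  assert (Hterm : forall n, 0 <= c n * r ^ (n + 2) <= r * r * c n).
  { intros n.
    assert (Hc : 0 <= c n) by apply Cmod_ge_0.
    assert (Hp : 0 <= r ^ n <= 1).
    { split; [now apply pow_le | rewrite <- (pow1 n); apply pow_incr; lra]. }
    rewrite pow_add.
    replace (c n * (r ^ n * r ^ 2)) with (r * r * c n * r ^ n) by ring.
    assert (H : 0 <= r * r * c n) by (repeat apply Rmult_le_pos; assumption).
    nra. }
  assert (Hb : ex_series (fun n => r * r * c n)).
  { apply (@ex_series_scal_l R_AbsRing); exact ex_series_coef. }
  split.
  - apply (@ex_series_le R_AbsRing R_CompleteNormedModule)
      with (fun n => r * r * c n); [|exact Hb].
    intros n; destruct (Hterm n).
    change (Rabs (c n * r ^ (n + 2)) <= r * r * c n).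
    rewrite Rabs_pos_eq; assumption.
  (* A common lower bound of the moduli lies below the infimum, even if the frontier is empty and
     the infimum is infinite. *)
  - apply (proj2 (Glb_Rbar_correct _)).
    intros x [w [Hw ->]]; simpl.
    rewrite Hf0; replace (w - 0)%C with w by ring.
    apply frontier_lower_bound in Hw.
    eapply Rle_trans; [|exact Hw].
    assert (HS := Series_le _ _ Hterm Hb).
    rewrite Series_scal_l in HS; fold c.
    apply Rle_trans with (r + r * r * Series c); [apply Rplus_le_compat_l; exact HS|].
    (* As [Series c <= 1 / 2], it suffices that [(1 + r * r) / 2 <= 1 - r], which is [Hq]
       rearranged. *)
    nra.
Qed.

End Coefficients.

(** * The extremal function and sharpness of the radius *)

(** Equal to [((z + 1)^2 - 1) / 2]; its one coefficient attains the bound [1 / 2] of [Omega_A]. *)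
Definition extremal (z : C) : C := (z + RtoC (1 / 2) * (z * z))%C.

Definition extremal_coef (n : nat) : C :=
  match n with 2%nat => RtoC (1 / 2) | _ => RtoC 0 end.

Lemma extremal_coef_tail (n : nat) : extremal_coef (S n + 2) = RtoC 0.
Proof. now replace (S n + 2)%nat with (S (S (S n))) by lia. Qed.

(* The two normed modules have the same norm, but distinct (equivalent) uniform
   structures, so they are not convertible. *)
Lemma is_derive_C_NormedModule (f : C -> C) (z l : C) :
  @is_derive C_AbsRing (AbsRing_NormedModule C_AbsRing) f z l ->
  @is_derive C_AbsRing C_NormedModule f z l.
Proof.
  intros [[Hadd Hscal Hnorm] Hdom].
  split; [split; [exact Hadd | exact Hscal | exact Hnorm] | exact Hdom].
Qed.

Lemma is_derive_extremal (z : C) :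
  @is_derive C_AbsRing C_NormedModule extremal z (1 + z)%C.
Proof.
  assert (Hid := @is_derive_id C_AbsRing z).
  assert (Hsq := @is_derive_mult C_AbsRing _ _ z _ _ Hid Hid Cmult_comm).
  assert (Hsc := @is_derive_mult C_AbsRing _ _ z _ _
    (@is_derive_const C_AbsRing (AbsRing_NormedModule C_AbsRing) (RtoC (1 / 2)) z)
    Hsq Cmult_comm).
  assert (H := @is_derive_plus C_AbsRing (AbsRing_NormedModule C_AbsRing)
    _ _ z _ _ Hid Hsc).
  assert (E : (1 + (0 * (z * z) + RtoC (1 / 2) * (1 * z + z * 1)))%C = (1 + z)%C).
  { rewrite RtoC_div by lra; field. }
  rewrite <- E; exact (is_derive_C_NormedModule _ _ _ H).
Qed.

Lemma extremal_expansion : has_expansion extremal extremal_coef.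
Proof.
  intros z _.
  replace (extremal z - z)%C with (extremal_coef (0 + 2) * z ^ (0 + 2))%C.
  - apply (@is_series_head C_AbsRing C_NormedModule
      (fun n => (extremal_coef (n + 2) * z ^ (n + 2))%C)).
    intros n; rewrite extremal_coef_tail; apply Cmult_0_l.
  - unfold extremal; simpl; ring.
Qed.

Lemma extremal_Omega : Omega_A extremal.
Proof.
  split; [split; [|split]|].
  - intros z _; eexists; apply is_derive_extremal.
  - unfold extremal; ring.
  - replace (RtoC 1) with (1 + 0)%C by ring; apply is_derive_extremal.
  - exists extremal_coef; split; [exact extremal_expansion|].
    assert (H : is_series
      (fun n : nat => (INR (n + 2) - 1) * Cmod (extremal_coef (n + 2))) (1 / 2)).
    { replace (1 / 2) with ((INR (0 + 2) - 1) * Cmod (extremal_coef (0 + 2))).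
      - apply (@is_series_head R_AbsRing R_NormedModule
          (fun n => (INR (n + 2) - 1) * Cmod (extremal_coef (n + 2)))).
        intros n; rewrite extremal_coef_tail, Cmod_0; apply Rmult_0_r.
      - simpl; rewrite Cmod_R, Rabs_pos_eq; lra. }
    split; [eexists; exact H | rewrite (is_series_unique _ _ H); lra].
Qed.

(** The only preimage of [- (1 / 2)] is [-1], which lies on the unit circle and is approached along
    the real axis. *)
Lemma extremal_frontier : frontier (disc_image extremal) (RtoC (- (1 / 2))).
Proof.
  intros eps Heps; split.
  (* The point [d - 1] is in the disc, and its value differs from [- (1 / 2)] by
     [d * d / 2 <= eps / 2]. *)
  - set (d := Rmin 1 eps).
    assert (Hd : 0 < d <= 1 /\ d <= eps).
    { unfold d; repeat split; [apply Rmin_glb_lt; lra | apply Rmin_l | apply Rmin_r]. }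
    exists (extremal (RtoC (d - 1))); split.
    + exists (RtoC (d - 1)); split; [|reflexivity].
      unfold unit_disc; rewrite Cmod_R; apply Rabs_def1; lra.
    + replace (extremal (RtoC (d - 1)) - RtoC (- (1 / 2)))%C
        with (RtoC (d * d / 2)).
      * rewrite Cmod_R, Rabs_pos_eq; nra.
      * unfold extremal; rewrite <- !RtoC_mult, <- RtoC_plus, <- RtoC_minus.
        f_equal; field.
  - exists (RtoC (- (1 / 2))); split.
    + (* [extremal z = -1/2] amounts to [(z + 1)^2 = 0]. *)
      intros [z [Hz Ez]].
      assert (E : ((z + 1) * (z + 1) = 0)%C).
      { replace ((z + 1) * (z + 1))%C
          with (2 * (extremal z - RtoC (- (1 / 2))))%C.
        - rewrite Ez; ring.
        - unfold extremal; rewrite RtoC_opp, RtoC_div by lra; field. }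
      apply (f_equal Cmod) in E; rewrite Cmod_mult, Cmod_0 in E.
      apply Rmult_integral in E.
      assert (E1 : (z + 1)%C = 0) by (apply Cmod_eq_0; tauto).
      unfold unit_disc in Hz.
      replace z with ((z + 1) - 1)%C in Hz by ring.
      rewrite E1 in Hz; replace (0 - 1)%C with (- (1))%C in Hz by ring.
      rewrite Cmod_m1 in Hz; lra.
    + replace (RtoC (- (1 / 2)) - RtoC (- (1 / 2)))%C with (RtoC 0) by ring.
      now rewrite Cmod_0.
Qed.

(** The left side is [r + r * r / 2] and the distance is at most [1 / 2], so the inequality would
    force [(r + 1)^2 <= 2]. *)
Lemma extremal_Bohr_fails (r : R) :
  sqrt 2 - 1 < r -> ~ Bohr_inequality extremal extremal_coef r.
Proof.
  intros Hr [_ HB].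
  assert (Hq : 2 < (r + 1) * (r + 1)).
  { rewrite <- (sqrt_sqrt 2) at 1 by lra.
    assert (H := sqrt_pos 2); nra. }
  assert (HS : Series (fun n : nat => Cmod (extremal_coef (n + 2)) * r ^ (n + 2))
               = r * r / 2).
  { apply is_series_unique.
    replace (r * r / 2) with (Cmod (extremal_coef (0 + 2)) * r ^ (0 + 2)).
    - apply (@is_series_head R_AbsRing R_NormedModule
        (fun n => Cmod (extremal_coef (n + 2)) * r ^ (n + 2))).
      intros n; rewrite extremal_coef_tail, Cmod_0; apply Rmult_0_l.
    - simpl; rewrite Cmod_R, Rabs_pos_eq; lra. }
  rewrite HS in HB.
  assert (Hd : Rbar_le (dist_to_set (extremal (RtoC 0)) (frontier (disc_image extremal)))
                       (1 / 2)).
  { apply (proj1 (Glb_Rbar_correct _)).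
    exists (RtoC (- (1 / 2))); split; [exact extremal_frontier|].
    replace (RtoC (- (1 / 2)) - extremal (RtoC 0))%C with (RtoC (- (1 / 2)))
      by (unfold extremal; ring).
    rewrite Cmod_R, Rabs_Ropp, Rabs_pos_eq; lra. }
  assert (H := Rbar_le_trans _ _ _ HB Hd); simpl in H; lra.
Qed.

Theorem theorem7p2 :
  (forall (f : C -> C) (a : nat -> C),
     Omega_A f -> has_expansion f a ->
     forall r : R, 0 <= r <= sqrt 2 - 1 -> Bohr_inequality f a r) /\
  (forall rho : R, sqrt 2 - 1 < rho ->
     ~ (forall (f : C -> C) (a : nat -> C),
          Omega_A f -> has_expansion f a ->
          forall r : R, 0 <= r <= rho -> r < 1 -> Bohr_inequality f a r)).
Proof.
  split.
  - intros f a [[_ [Hf0 _]] [b [Hb [Hex Hle]]]] Ha r Hr.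
    (* The bound is known for the sequence [b] from [Omega_A]; uniqueness transfers it to the given
       [a]. *)
    assert (E : forall n, (INR (n + 2) - 1) * Cmod (b (n + 2)%nat)
                          = (INR (n + 2) - 1) * Cmod (a (n + 2)%nat)).
    { intros n; now rewrite (has_expansion_unique f a b Ha Hb n). }
    apply Bohr_inequality_of_coef; auto.
    + now apply (ex_series_ext _ _ E).
    + now rewrite <- (Series_ext _ _ E).
  - intros rho Hrho H.
    assert (H1 : 1 < sqrt 2 < 2).
    { split; [rewrite <- sqrt_1 at 1; apply sqrt_lt_1; lra|].
      apply Rsqr_incrst_0; unfold Rsqr; [rewrite sqrt_sqrt|..]; try lra.
      apply sqrt_pos. }
    (* A midpoint, hence strictly above [sqrt 2 - 1], below 1 and at most [rho]. *)
    set (r := (sqrt 2 - 1 + Rmin rho 1) / 2).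
    assert (Hm : sqrt 2 - 1 < Rmin rho 1) by (apply Rmin_glb_lt; lra).
    assert (Hm1 := Rmin_l rho 1); assert (Hm2 := Rmin_r rho 1).
    apply (extremal_Bohr_fails r); [unfold r; lra|].
    apply H; [exact extremal_Omega | exact extremal_expansion | unfold r; lra..].
Qed.
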